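(* Let $\mathcal{H}$ be a complex Hilbert space of finite dimension $d$, let $\Lambda$ be a quantum channel mapping states on $\mathcal{H}$ to states on $\mathcal{H}$, let $\boldsymbol{\Lambda}=\Lambda\otimes\Lambda$, and let $\mathcal{E}$ be a convex measure of entanglement on $\mathcal{S}(\mathcal{H}\otimes\mathcal{H})$. Suppose that the optimization in the saved entanglement $$\mathrm{SE}=\max_{\boldsymbol{\rho}\in\mathcal{S}(\mathcal{H}\otimes\mathcal{H})}\left[\max_{U\in\mathcal{U}(\mathcal{H})}\mathcal{E}\left(\boldsymbol{\Lambda}\left((I_d\otimes U)\boldsymbol{\rho}(I_d\otimes U)^\dagger\right)\right)-\mathcal{E}(\boldsymbol{\Lambda}(\boldsymbol{\rho}))\right]$$ is achieved by at least one optimal pair $(\boldsymbol{U}_{\max},\boldsymbol{\rho}_{\max})$, where $\boldsymbol{U}_{\max}=I_d\otimes U_{\max}$ with $U_{\max}\in\mathcal{U}(\mathcal{H})$ and $\boldsymbol{\rho}_{\max}$ is a bipartite pure state on $\mathcal{H}\otimes\mathcal{H}$, i.e. $$\mathrm{SE}=\mathcal{E}\left(\boldsymbol{\Lambda}\left(\boldsymbol{U}_{\max}\boldsymbol{\rho}_{\max}\boldsymbol{U}_{\max}^\dagger\right)\right)-\mathcal{E}(\boldsymbol{\Lambda}(\boldsymbol{\rho}_{\max})).$$ Define $$\mathrm{EB1}=\inf\; p_2\left[\mathcal{E}(\boldsymbol{\rho}')-\mathcal{E}(\boldsymbol{\Lambda}(\boldsymbol{\rho}_{\max}))\right],\qquad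 \mathrm{EB2}=\inf\; p_2\,\mathcal{E}(\boldsymbol{\rho}'),$$ where both infima are over all such optimal pairs $(\boldsymbol{U}_{\max},\boldsymbol{\rho}_{\max})$ and all decompositions $$\boldsymbol{\Lambda}\left(\boldsymbol{U}_{\max}\boldsymbol{\rho}_{\max}\boldsymbol{U}_{\max}^\dagger\right)=p_1\,\boldsymbol{\Lambda}(\boldsymbol{\rho}_{\max})+p_2\,\boldsymbol{\rho}',\qquad p_1,p_2\ge 0,\ p_1+p_2=1,\ \boldsymbol{\rho}'\in\mathcal{S}(\mathcal{H}\otimes\mathcal{H}).$$ Then $$\mathrm{SE}\le \mathrm{EB1}\le \mathrm{EB2}.$$
   Context: $\mathcal{S}(\mathcal{K})$ denotes the set of density operators (positive semidefinite, trace one) on a finite-dimensional Hilbert space $\mathcal{K}$; a pure state is a rank-one density operator; $\mathcal{U}(\mathcal{H})$ denotes the set of unitary operators on $\mathcal{H}$; $I_d$ is the identity operator on $\mathcal{H}$. A quantum channel is a completely positive trace-preserving linear map. Measure of entanglement: a function $\mathcal{E}:\mathcal{S}(\mathcal{H}\otimes\mathcal{H})\to[0,\infty)$ which is unchanged under local unitary operations, i.e. $\mathcal{E}\left((V\otimes W)\boldsymbol{\rho}(V\otimes W)^\dagger\right)=\mathcal{E}(\boldsymbol{\rho})$ for all $\boldsymbol{\rho}\in\mathcal{S}(\mathcal{H}\otimes\mathcal{H})$ and $V,W\in\mathcal{U}(\mathcal{H})$. It is convex if $\mathcal{E}(q\boldsymbol{\rho}+(1-q)\boldsymbol{\sigma})\le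 q\,\mathcal{E}(\boldsymbol{\rho})+(1-q)\,\mathcal{E}(\boldsymbol{\sigma})$ for all $\boldsymbol{\rho},\boldsymbol{\sigma}\in\mathcal{S}(\mathcal{H}\otimes\mathcal{H})$ and $q\in[0,1]$. The quantity $\mathrm{SE}$ displayed in the claim is, by definition, the saved entanglement of the local channel $\boldsymbol{\Lambda}=\Lambda\otimes\Lambda$ with respect to $\mathcal{E}$. *)

(* Defs.v *)
From HB Require Import structures.
From mathcomp Require Import all_boot all_order all_algebra.
From mathcomp Require Import all_classical all_reals ereal.
From mathcomp Require Import complex mxtens.

Set Implicit Arguments.
Unset Strict Implicit.
Unset Printing Implicit Defensive.

Import Order.TTheory GRing.Theory Num.Theory.
Local Open Scope classical_set_scope.
Local Open Scope ring_scope.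
Local Open Scope complex_scope.
Local Open Scope sesquilinear_scope.

(* The Hilbert space of dimension [n] is C^n with C = R[i]; operators on it are
   square matrices, and operators on C^m (x) C^n are matrices of size [m * n]
   under the index pairing [mxtens_index], for which [tensmx] is the tensor
   product of operators. *)

Definition psd (R : realType) (n : nat) (A : 'M[R[i]]_n) : Prop :=
  A \is hermsymmx /\
  forall x : 'cV[R[i]]_n, 0 <= (x ^t* *m A *m x) 0 0.

Definition state (R : realType) (n : nat) (rho : 'M[R[i]]_n) : Prop :=
  psd rho /\ \tr rho = 1.

Definition pure_state (R : realType) (n : nat) (rho : 'M[R[i]]_n) : Prop :=
  state rho /\ \rank rho = 1%N.

Definition conj_by (R : realType) (n : nat) (V rho : 'M[R[i]]_n) :
  'M[R[i]]_n := V *m rho *m V ^t*.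

(* [Phi (x) Psi], obtained by expanding [X] in the basis of the tensor products
   of matrix units; meant for linear [Phi] and [Psi] (see [tensor_map_tens]). *)
Definition tensor_map (R : realType) (m m' n n' : nat)
    (Phi : 'M[R[i]]_m -> 'M[R[i]]_m') (Psi : 'M[R[i]]_n -> 'M[R[i]]_n')
    (X : 'M[R[i]]_(m * n)) : 'M[R[i]]_(m' * n') :=
  \sum_(i < m) \sum_(j < m) \sum_(k < n) \sum_(l < n)
    X (mxtens_index (i, k)) (mxtens_index (j, l)) *:
      tensmx (Phi (delta_mx i j)) (Psi (delta_mx k l)).

Lemma tensor_map_tens (R : realType) (m m' n n' : nat)
    (Phi : {linear 'M[R[i]]_m -> 'M[R[i]]_m'})
    (Psi : {linear 'M[R[i]]_n -> 'M[R[i]]_n'})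
    (A : 'M[R[i]]_m) (B : 'M[R[i]]_n) :
  tensor_map Phi Psi (tensmx A B) = tensmx (Phi A) (Psi B).
Proof.
rewrite {2}(matrix_sum_delta A) {2}(matrix_sum_delta B) !linear_sum /=.
apply/matrixP => u v; rewrite /tensor_map [RHS]mxE !summxE mulr_suml.
apply: eq_bigr => i _; rewrite linear_sum !summxE mulr_suml.
apply: eq_bigr => j _; rewrite summxE mulr_sumr.
apply: eq_bigr => k _; rewrite linear_sum !summxE mulr_sumr.
apply: eq_bigr => l _; rewrite !linearZ !mxE !mxtens_indexK /=.
by rewrite mulrACA.
Qed.

Definition completely_positive (R : realType) (m n : nat)
    (Phi : 'M[R[i]]_m -> 'M[R[i]]_n) : Prop :=
  forall (k : nat) (X : 'M[R[i]]_(k * m)),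
    psd X -> psd (tensor_map (@id 'M[R[i]]_k) Phi X).

Definition quantum_channel (R : realType) (m n : nat)
    (Phi : {linear 'M[R[i]]_m -> 'M[R[i]]_n}) : Prop :=
  completely_positive Phi /\ forall A : 'M[R[i]]_m, \tr (Phi A) = \tr A.

(* A real function on S(H (x) H) is represented by a function on all matrices
   of which only the values on states are constrained or used. *)
Definition entanglement_measure (R : realType) (d : nat)
    (E : 'M[R[i]]_(d * d) -> R) : Prop :=
  (forall rho, state rho -> 0 <= E rho) /\
  (forall (rho : 'M[R[i]]_(d * d)) (V W : 'M[R[i]]_d),
     state rho -> V \is unitarymx -> W \is unitarymx ->
     E (conj_by (tensmx V W) rho) = E rho).

Definition convex_on_states (R : realType) (n : nat)
    (E : 'M[R[i]]_n -> R) : Prop :=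
  forall (rho sigma : 'M[R[i]]_n) (q : R),
    state rho -> state sigma -> 0 <= q <= 1 ->
    E (q%:C *: rho + (1 - q)%:C *: sigma) <= q * E rho + (1 - q) * E sigma.

Definition local_op (R : realType) (d : nat) (U : 'M[R[i]]_d) :
  'M[R[i]]_(d * d) := tensmx (1%:M : 'M[R[i]]_d) U.

(* Both maxima are read as suprema in the extended reals, so that the quantity
   is defined without assuming that they are finite or attained. *)
Definition saved_entanglement (R : realType) (d : nat)
    (L : 'M[R[i]]_(d * d) -> 'M[R[i]]_(d * d))
    (E : 'M[R[i]]_(d * d) -> R) : \bar R :=
  ereal_sup [set (ereal_sup [set (E (L (conj_by (local_op U) rho)))%:E
                            | U in [set U : 'M[R[i]]_d | U \is unitarymx]]
                  - (E (L rho))%:E)%E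
            | rho in [set rho : 'M[R[i]]_(d * d) | state rho]].

Definition optimal_pair (R : realType) (d : nat)
    (L : 'M[R[i]]_(d * d) -> 'M[R[i]]_(d * d)) (E : 'M[R[i]]_(d * d) -> R)
    (U : 'M[R[i]]_d) (rho : 'M[R[i]]_(d * d)) : Prop :=
  [/\ U \is unitarymx, pure_state rho &
      saved_entanglement L E =
        (E (L (conj_by (local_op U) rho)) - E (L rho))%:E].

Definition decomposition (R : realType) (d : nat)
    (L : 'M[R[i]]_(d * d) -> 'M[R[i]]_(d * d))
    (U : 'M[R[i]]_d) (rho : 'M[R[i]]_(d * d))
    (p1 p2 : R) (rho' : 'M[R[i]]_(d * d)) : Prop :=
  [/\ 0 <= p1, 0 <= p2, p1 + p2 = 1, state rho' &
      L (conj_by (local_op U) rho) = p1%:C *: L rho + p2%:C *: rho'].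

Definition EB1 (R : realType) (d : nat)
    (L : 'M[R[i]]_(d * d) -> 'M[R[i]]_(d * d))
    (E : 'M[R[i]]_(d * d) -> R) : \bar R :=
  ereal_inf [set x : \bar R | exists U rho p1 p2 rho',
    [/\ optimal_pair L E U rho, decomposition L U rho p1 p2 rho' &
        x = (p2 * (E rho' - E (L rho)))%:E]].

Definition EB2 (R : realType) (d : nat)
    (L : 'M[R[i]]_(d * d) -> 'M[R[i]]_(d * d))
    (E : 'M[R[i]]_(d * d) -> R) : \bar R :=
  ereal_inf [set x : \bar R | exists U rho p1 p2 rho',
    [/\ optimal_pair L E U rho, decomposition L U rho p1 p2 rho' &
        x = (p2 * E rho')%:E]].

(* Main.v *)
(** For an optimal pair, convexity of [E] along
    [L(U rho U^dagger) = p1 L(rho) + p2 rho'] gives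
    [SE <= p1 E(L rho) + p2 E(rho') - E(L rho) = p2 (E(rho') - E(L rho))], and
    [E(L rho) >= 0] gives the second inequality.  Both need [L rho] to be a
    state; positivity comes from the factorisation
    [Lambda (x) Lambda = (id (x) Lambda) o (Lambda (x) id)], where
    [Lambda (x) id] is [id (x) Lambda] conjugated by the flip of the factors. *)

Require Import Defs.
From HB Require Import structures.
From mathcomp Require Import all_boot all_order all_algebra.
From mathcomp Require Import all_classical all_reals ereal.
From mathcomp Require Import complex mxtens ring.

Set Implicit Arguments.
Unset Strict Implicit.
Unset Printing Implicit Defensive.

Import Order.TTheory GRing.Theory Num.Theory.
Local Open Scope classical_set_scope.
Local Open Scope ring_scope.
Local Open Scope complex_scope.
Local Open Scope sesquilinear_scope.

Lemma trmxC_mul (R : realType) (m n p : nat)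
    (A : 'M[R[i]]_(m, n)) (B : 'M[R[i]]_(n, p)) :
  (A *m B) ^t* = B ^t* *m A ^t*.
Proof. by rewrite trmx_mul map_mxM. Qed.

Lemma psd_congr (R : realType) (m n : nat)
    (A : 'M[R[i]]_(m, n)) (X : 'M[R[i]]_n) :
  psd X -> psd (A *m X *m A ^t*).
Proof.
move=> [hX pX]; split=> [|x].
  move: hX => /is_hermitianmxP; rewrite expr0 scale1r => hX.
  apply/is_hermitianmxP; rewrite expr0 scale1r.
  by rewrite !trmxC_mul -hX trmxCK mulmxA.
by have := pX (A ^t* *m x); rewrite trmxC_mul trmxCK !mulmxA.
Qed.

(** Reindexing is the congruence by the 0/1 matrix [rowsub f 1%:M], so [psd_congr] applies. *)
Lemma psd_mxsub (R : realType) (m n : nat) (f : 'I_m -> 'I_n)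
    (X : 'M[R[i]]_n) :
  psd X -> psd (mxsub f f X).
Proof.
have -> : mxsub f f X = rowsub f 1%:M *m X *m (rowsub f 1%:M) ^t*.
  rewrite mul_rowsub_mx mul1mx.
  have -> : (rowsub f (1%:M : 'M[R[i]]_n)) ^t* = colsub f 1%:M.
    by apply/matrixP=> i j; rewrite !mxE rmorph_nat eq_sym.
  by rewrite mulmx_colsub mulmx1; apply/matrixP=> i j; rewrite !mxE.
exact: psd_congr.
Qed.

Fact tensor_map_is_linear (R : realType) (m m' n n' : nat)
    (Phi : 'M[R[i]]_m -> 'M[R[i]]_m') (Psi : 'M[R[i]]_n -> 'M[R[i]]_n') :
  linear (tensor_map Phi Psi).
Proof.
move=> a X Y; rewrite /tensor_map.
do 4![rewrite scaler_sumr -big_split; apply: eq_bigr => ? _ /=].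
by rewrite !mxE scalerDl scalerA.
Qed.

HB.instance Definition _ (R : realType) (m m' n n' : nat)
    (Phi : 'M[R[i]]_m -> 'M[R[i]]_m') (Psi : 'M[R[i]]_n -> 'M[R[i]]_n') :=
  GRing.isLinear.Build R[i] 'M[R[i]]_(m * n) 'M[R[i]]_(m' * n') *:%R
    (tensor_map Phi Psi) (tensor_map_is_linear Phi Psi).

(** Complete positivity is phrased with the bare [id]; its convertible form [idfun] supplies the
    linear structure that [tensor_map_tens] asks for. *)
Lemma tensor_map_idl_tens (R : realType) (m n n' : nat)
    (Psi : {linear 'M[R[i]]_n -> 'M[R[i]]_n'})
    (A : 'M[R[i]]_m) (B : 'M[R[i]]_n) :
  tensor_map id Psi (tensmx A B) = tensmx A (Psi B).
Proof. exact: (tensor_map_tens idfun Psi A B). Qed.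

(** Only the inner map is expanded; the outer one passes through the four sums by linearity and acts
    on each elementary tensor. *)
Lemma tensor_map_factor (R : realType) (m m' n n' : nat)
    (Phi : {linear 'M[R[i]]_m -> 'M[R[i]]_m'})
    (Psi : {linear 'M[R[i]]_n -> 'M[R[i]]_n'}) (X : 'M[R[i]]_(m * n)) :
  tensor_map Phi Psi X = tensor_map id Psi (tensor_map Phi id X).
Proof.
rewrite [tensor_map Phi id X]/tensor_map.
do 4![rewrite linear_sum; apply: eq_bigr => ? _ /=].
by rewrite linearZ /= tensor_map_idl_tens.
Qed.

Lemma tensor_map_id (R : realType) (m n : nat) (X : 'M[R[i]]_(m * n)) :
  tensor_map id id X = X.
Proof.
apply/matrixP=> u v; rewrite -[u]mxtens_unindexK -[v]mxtens_unindexK.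
case: (mxtens_unindex u) (mxtens_unindex v) => [a b] [c e].
rewrite /tensor_map summxE (bigD1 a) //=.
(* Each of the four sums collapses in turn to the index read off from the entry, as the other matrix
   units vanish there. *)
rewrite [X in _ + X]big1 ?addr0 => [|i ia]; last first.
  rewrite summxE big1 // => j _; rewrite summxE big1 // => k _.
  rewrite summxE big1 // => l _.
  by rewrite mxE tensmxE !mxE [a == i]eq_sym (negPf ia) mul0r mulr0.
rewrite summxE (bigD1 c) //=.
rewrite [X in _ + X]big1 ?addr0 => [|j jc]; last first.
  rewrite summxE big1 // => k _; rewrite summxE big1 // => l _.
  by rewrite mxE tensmxE !mxE [c == j]eq_sym (negPf jc) andbF mul0r mulr0.
rewrite summxE (bigD1 b) //=.
rewrite [X in _ + X]big1 ?addr0 => [|k kb]; last first.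
  rewrite summxE big1 // => l _.
  by rewrite mxE tensmxE !mxE [b == k]eq_sym (negPf kb) !mulr0.
rewrite summxE (bigD1 e) //=.
rewrite [X in _ + X]big1 ?addr0 => [|l le]; last first.
  by rewrite mxE tensmxE !mxE [e == l]eq_sym (negPf le) andbF !mulr0.
by rewrite mxE tensmxE !mxE !eqxx !mulr1.
Qed.

Definition mxtens_flip (m n : nat) (i : 'I_(m * n)) : 'I_(n * m) :=
  mxtens_index ((mxtens_unindex i).2, (mxtens_unindex i).1).

(** Conjugation by the swap unitary, written as a reindexing so that [psd_mxsub] gives its
    positivity. *)
Definition tens_flip (R : realType) (m n : nat) (X : 'M[R[i]]_(m * n)) :
    'M[R[i]]_(n * m) :=
  mxsub (@mxtens_flip n m) (@mxtens_flip n m) X.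

Fact tens_flip_is_linear (R : realType) (m n : nat) :
  linear (@tens_flip R m n).
Proof. by move=> a X Y; apply/matrixP=> u v; rewrite !mxE. Qed.

HB.instance Definition _ (R : realType) (m n : nat) :=
  GRing.isLinear.Build R[i] 'M[R[i]]_(m * n) 'M[R[i]]_(n * m) *:%R
    (@tens_flip R m n) (@tens_flip_is_linear R m n).

Lemma tens_flip_tens (R : realType) (m n : nat)
    (A : 'M[R[i]]_m) (B : 'M[R[i]]_n) :
  tens_flip (tensmx A B) = tensmx B A.
Proof. by apply/matrixP=> u v; rewrite !mxE !mxtens_indexK mulrC. Qed.

(** Complete positivity controls the identity on the left factor only; this carries it over to the
    right factor. *)
Lemma tensor_map_flip (R : realType) (m m' n : nat)
    (Phi : {linear 'M[R[i]]_m -> 'M[R[i]]_m'}) (X : 'M[R[i]]_(m * n)) :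
  tensor_map Phi id X = tens_flip (tensor_map id Phi (tens_flip X)).
Proof.
(* The right-hand side is packed into one linear map, then [X] is expanded in matrix units by
   [tensor_map_id], so that elementary tensors suffice. *)
pose F : {linear 'M[R[i]]_(m * n) -> 'M[R[i]]_(m' * n)} :=
  @tens_flip R n m' \o tensor_map id Phi \o @tens_flip R m n.
rewrite -[RHS]/(F X) -[in RHS](tensor_map_id X) /tensor_map.
do 4![rewrite linear_sum; apply: eq_bigr => ? _].
by rewrite linearZ /= tens_flip_tens tensor_map_idl_tens tens_flip_tens.
Qed.

Lemma mxtrace_tens (R : realType) (m n : nat)
    (A : 'M[R[i]]_m) (B : 'M[R[i]]_n) :
  \tr (tensmx A B) = \tr A * \tr B.
Proof.
rewrite /mxtrace mulr_sum; apply: eq_bigr => i _.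
by rewrite -[in LHS](mxtens_unindexK i) tensmxE.
Qed.

(** Expanding [X] by [tensor_map_id] as well lets both traces be compared term by term. *)
Lemma mxtrace_tensor_map (R : realType) (m m' n n' : nat)
    (Phi : 'M[R[i]]_m -> 'M[R[i]]_m') (Psi : 'M[R[i]]_n -> 'M[R[i]]_n')
    (X : 'M[R[i]]_(m * n)) :
  (forall A, \tr (Phi A) = \tr A) -> (forall B, \tr (Psi B) = \tr B) ->
  \tr (tensor_map Phi Psi X) = \tr X.
Proof.
move=> trPhi trPsi; rewrite -[in RHS](tensor_map_id X) /tensor_map.
do 4![rewrite !linear_sum; apply: eq_bigr => ? _ /=].
by rewrite !linearZ /= !mxtrace_tens trPhi trPsi.
Qed.

Lemma state_tensor_map (R : realType) (m m' n n' : nat)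
    (Phi : {linear 'M[R[i]]_m -> 'M[R[i]]_m'})
    (Psi : {linear 'M[R[i]]_n -> 'M[R[i]]_n'}) (rho : 'M[R[i]]_(m * n)) :
  quantum_channel Phi -> quantum_channel Psi ->
  state rho -> state (tensor_map Phi Psi rho).
Proof.
move=> [cpPhi trPhi] [cpPsi trPsi] [psd_rho tr_rho]; split; last first.
  by rewrite mxtrace_tensor_map.
rewrite tensor_map_factor; apply: cpPsi; rewrite tensor_map_flip.
exact/psd_mxsub/cpPhi/psd_mxsub.
Qed.

Theorem mainTheorem2 (R : realType) (d : nat)
    (Lambda : {linear 'M[R[i]]_d -> 'M[R[i]]_d})
    (E : 'M[R[i]]_(d * d) -> R)
    (hLambda : quantum_channel Lambda)
    (hE : entanglement_measure E) (hconv : convex_on_states E)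
    (hopt : exists (Umax : 'M[R[i]]_d) (rhomax : 'M[R[i]]_(d * d)),
        optimal_pair (tensor_map Lambda Lambda) E Umax rhomax) :
  (saved_entanglement (tensor_map Lambda Lambda) E
     <= EB1 (tensor_map Lambda Lambda) E)%E /\
  (EB1 (tensor_map Lambda Lambda) E <= EB2 (tensor_map Lambda Lambda) E)%E.
Proof.
split.
  apply: le_ereal_inf_tmp => _ [U [rho [p1 [p2 [rho' [opt dec ->]]]]]].
  (* Every optimal pair attains the same supremum, so it may be replaced by the value at the pair
     under consideration. *)
  have [_ [st _] ->] := opt; have [p1_ge0 p2_ge0 p12 st' ->] := dec.
  have p2E : p2 = 1 - p1 by rewrite -p12 addrC addKr.
  have p1_le1 : p1 <= 1 by rewrite -subr_ge0 -p2E.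
  have stL := state_tensor_map hLambda hLambda st.
  have := hconv _ rho' p1 stL st'.
  rewrite p1_ge0 p1_le1 -p2E lee_fin => /(_ isT) le_E.
  apply: (le_trans (lerB le_E (lexx _))).
  (* The two sides are in fact equal, because the weights sum to 1. *)
  by rewrite p2E le_eqVlt; apply/orP; left; apply/eqP; ring.
apply: le_ereal_inf_tmp => _ [U [rho [p1 [p2 [rho' [opt dec ->]]]]]].
apply: ge_ereal_inf.
(* The same pair and decomposition index a term of [EB1], so the infima are compared termwise. *)
exists (p2 * (E rho' - E (tensor_map Lambda Lambda rho)))%:E.
  by exists U, rho, p1, p2, rho'.
have [_ [st _] _] := opt; have [_ p2_ge0 _ _ _] := dec.
rewrite lee_fin ler_wpM2l // gerBl.
by apply: hE.1; exact: state_tensor_map.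
Qed.
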